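(* The trivial variety $TR$ is the only $fa$-solid variety of semigroups; that is, a variety $V$ of semigroups is $fa$-solid if and only if $V=TR$.
   Context: The type is $\tau=(2)$ with one binary operation symbol $f$. $W_{(2)}(X)$ is the set of terms of this type over $X=\{x_1,x_2,\ldots\}$. A hypersubstitution $\sigma$ of type $(2)$ assigns to $f$ a term $\sigma(f)\in W_{(2)}(\{x_1,x_2\})$; $Hyp(2)$ is the set of all of them. For a term $u$ over $\{x_1,x_2\}$, $S^2(u,t_1,t_2)$ is the term obtained from $u$ by simultaneously substituting $t_1$ for $x_1$ and $t_2$ for $x_2$. For $\sigma\in Hyp(2)$, mappings $\sigma^{fa},\sigma^{sa}:W_{(2)}(X)\to W_{(2)}(X)$ are defined by simultaneous recursion: $\sigma^{fa}(x):=\sigma^{sa}(x):=x$ for $x\in X$; and $\sigma^{fa}(f(t_1,t_2)):=S^2(\sigma(f),\sigma^{sa}(t_1),\sigma^{sa}(t_2))$, $\sigma^{sa}(f(t_1,t_2)):=f(\sigma^{fa}(t_1),\sigma^{fa}(t_2))$. A variety of semigroups is a variety of algebras of type $(2)$ satisfying the associative law; $IdV$ is the set of all identities $s\approx t$ (with $s,t\in W_{(2)}(X)$) holding in $V$. $V$ is called $fa$-solid iff $\sigma^{fa}(s)\approx\sigma^{fa}(t)\in IdV$ for all $s\approx t\in IdV$ and all $\sigma\in Hyp(2)$. $TR$ is the variety of one-element (trivial) semigroups. *)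

(* Defs.v *)
From mathcomp Require Import all_boot.
From Stdlib Require Import FunctionalExtensionality ClassicalEpsilon.

Set Implicit Arguments.
Unset Strict Implicit.
Unset Printing Implicit Defensive.

Inductive term (X : Type) : Type :=
| Var of X
| App of term X & term X.

(* The alphabet x_1, x_2, ... is nat, with [Var n] standing for x_(n+1);
   the two-letter alphabet {x_1, x_2} is 'I_2. *)
Definition W := term nat.
Definition W2 := term 'I_2.

Fixpoint subst (X Y : Type) (g : X -> term Y) (u : term X) : term Y :=
  match u with
  | Var x => g x
  | App u1 u2 => App (subst g u1) (subst g u2)
  end.

Definition S2 (X : Type) (u : W2) (t1 t2 : term X) : term X :=
  subst (fun i : 'I_2 => if i == ord0 then t1 else t2) u.

(* As f is the only operation symbol, a hypersubstitution sigma is identified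
   with the term sigma(f). *)
Definition Hyp2 := W2.

Fixpoint hyp_fa (sigma : Hyp2) (t : W) {struct t} : W :=
  match t with
  | Var x => Var x
  | App t1 t2 => S2 sigma (hyp_sa sigma t1) (hyp_sa sigma t2)
  end
with hyp_sa (sigma : Hyp2) (t : W) {struct t} : W :=
  match t with
  | Var x => Var x
  | App t1 t2 => App (hyp_fa sigma t1) (hyp_fa sigma t2)
  end.

(* Carriers are arbitrary types rather than choiceTypes (as magmaType would
   require), so that arbitrary direct products can be formed. *)
Record algebra : Type := Algebra {
  carrier :> Type;
  op : carrier -> carrier -> carrier;
  carrier_inhabited : inhabited carrier
}.

Fixpoint eval (A : algebra) (v : nat -> A) (t : W) : A :=
  match t with
  | Var x => v x
  | App t1 t2 => op (eval v t1) (eval v t2)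
  end.

Definition satisfies (A : algebra) (s t : W) : Prop :=
  forall v : nat -> A, eval v s = eval v t.

Definition is_hom (A B : algebra) (h : A -> B) : Prop :=
  forall x y : A, h (op x y) = op (h x) (h y).

Lemma prod_inhabited (I : Type) (A : I -> algebra) :
  inhabited (forall i, A i).
Proof.
exact: (inhabits (fun i => epsilon (carrier_inhabited (A i)) (fun=> True))).
Qed.

Definition prod_algebra (I : Type) (A : I -> algebra) : algebra :=
  @Algebra (forall i, A i) (fun x y i => op (x i) (y i)) (prod_inhabited A).

Definition class := algebra -> Prop.

(* Varieties are classes closed under S, H and P.  Closure under S is stated
   for injective homomorphisms, i.e. for subalgebras up to isomorphism; since
   closure under H includes closure under isomorphism, this is the usual
   notion.  The index type of a product may be empty. *)
Definition is_variety (V : class) : Prop :=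
  [/\ forall (A B : algebra) (h : A -> B),
        is_hom h -> injective h -> V B -> V A,
      forall (A B : algebra) (h : A -> B),
        is_hom h -> (forall b, exists a, h a = b) -> V A -> V B
    & forall (I : Type) (A : I -> algebra),
        (forall i, V (A i)) -> V (prod_algebra A)].

Definition Id (V : class) (s t : W) : Prop :=
  forall A : algebra, V A -> satisfies A s t.

Definition assoc_lhs : W := App (App (Var 0) (Var 1)) (Var 2).
Definition assoc_rhs : W := App (Var 0) (App (Var 1) (Var 2)).

Definition is_semigroup_variety (V : class) : Prop :=
  is_variety V /\ Id V assoc_lhs assoc_rhs.

Definition fa_solid (V : class) : Prop :=
  forall (s t : W), Id V s t ->
  forall sigma : Hyp2, Id V (hyp_fa sigma s) (hyp_fa sigma t).

Definition TR : class :=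
  fun A => satisfies A assoc_lhs assoc_rhs /\ exists e : A, forall x : A, x = e.

Lemma TR_semigroup_variety : is_semigroup_variety TR.
Proof.
have one (A : algebra) : (forall x y : A, x = y) -> TR A.
  move=> A1; split=> [v|]; first exact: A1.
  by case: (carrier_inhabited A) => e; exists e.
split; last by move=> A [].
split=> [A B h _ inj_h [_ [e eP]] | A B h _ surj_h [_ [e eP]] | I A TRA].
- by apply: one => x y; apply: inj_h; rewrite (eP (h x)) (eP (h y)).
- apply: one => x y; case: (surj_h x) => a <-; case: (surj_h y) => b <-.
  by rewrite (eP a) (eP b).
- apply: one => x y; apply: functional_extensionality_dep => i.
  by case: (TRA i) => _ [e eP]; rewrite (eP (x i)) (eP (y i)).
Qed.

(* Main.v *)
(* Apply fa-solidity to the associative law: the hypersubstitution f |-> x_1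
   turns it into xy = x, and f |-> x_2 turns it into z = yz, so any two elements
   of an algebra of V are equal.  Conversely V contains every trivial algebra,
   as it contains the empty product. *)
From mathcomp Require Import all_boot.
From Stdlib Require Import FunctionalExtensionality.
Require Import Defs.

Lemma variety_trivial (V : class) (A : algebra) :
  is_variety V -> (forall x y : A, x = y) -> V A.
Proof.
case=> closedS _ closedP A1.
(* [of_void algebra] is the empty family, so [P] has exactly one point. The constant map from [A] to
   [P] is injective because [A] has at most one element. *)
pose P := prod_algebra (of_void algebra).
have pt : P by case.
apply: (closedS A P (fun _ => pt)).
- by move=> x y; apply: functional_extensionality_dep => -[].
- by move=> x y _; apply: A1.
- by apply: closedP => -[].
Qed.

Lemma fa_solid_trivial (V : class) (A : algebra) :
  Id V assoc_lhs assoc_rhs -> fa_solid V -> V A -> forall x y : A, x = y.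
Proof.
move=> assocV solidV VA x y.
(* [hyp_fa] projects the outer product, while [hyp_sa] keeps the inner [App]: a product thus
   survives on one side only. *)
have opl : op x y = x.
  exact: (solidV _ _ assocV (Var ord0) A VA (fun n => if n is 0 then x else y)).
(* Here the sides become [Var 2] and [App (Var 1) (Var 2)], so only the value at 2 has to be [y]. *)
have opr : y = op x y.
  exact: (solidV _ _ assocV (Var (lift ord0 ord0)) A VA
            (fun n => if n is 2 then y else x)).
by rewrite [RHS]opr opl.
Qed.

Theorem theorem3 (V : class) (hV : is_semigroup_variety V) :
  fa_solid V <-> (forall A : algebra, V A <-> TR A).
Proof.
case: hV => varV assocV; split=> [solidV A | VTR].
  split=> [VA | [_ [e eP]]].
    split; first exact: assocV.
    case: (carrier_inhabited A) => e; exists e => x.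
    exact: (fa_solid_trivial V A assocV solidV VA).
  by apply: variety_trivial => // x y; rewrite (eP x) (eP y).
move=> s t _ sigma A /VTR[_ [e eP]] v.
by rewrite (eP (eval v _)) [RHS]eP.
Qed.
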